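(* There exists a platypus containing a $3$-ear whose replacement with a $4$-ear does not yield a platypus.
   Context: Graphs are finite and simple, with at least three vertices. A graph is hamiltonian (traceable) if it contains a spanning cycle (spanning path). A platypus is a non-hamiltonian graph $G$ such that for every vertex $v$ of $G$ the vertex-deleted subgraph $G-v$ is traceable. In a $2$-connected graph $G$, a path $P \subset G$ on $k \ge 3$ vertices with end-vertices $v, w$ is called a $k$-ear if $\{v,w\}$ is a vertex-cut of $G$ and every vertex in $V(P)\setminus\{v,w\}$ has degree $2$ in $G$; moreover, ears are required to be maximal, i.e. there is no ear $P'$ with $P \subsetneq P'$. Replacing a $3$-ear $v x w$ with a $4$-ear means deleting its interior vertex $x$ and adding two new vertices $x_1, x_2$ together with the edges $v x_1, x_1 x_2, x_2 w$. *)

(* Defs.v *)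
From mathcomp Require Import all_boot.

Set Implicit Arguments.
Unset Strict Implicit.
Unset Printing Implicit Defensive.

Record sgraph := SGraph {
  vertex :> finType;
  adj : rel vertex;
  adj_sym : symmetric adj;
  adj_irrefl : irreflexive adj }.

Section Graph.
Variable G : sgraph.
Implicit Types (v w x y : G) (p q : seq G) (A S : {set G}).

Definition is_path p : bool := [&& 0 < size p, sorted (@adj G) p & uniq p].

(* [cycle] alone would accept K_2 traversed back and forth. *)
Definition is_cycle p : bool := [&& 2 < size p, cycle (@adj G) p & uniq p].

Definition spanning p : Prop := forall x, x \in p.

Definition traceable : Prop := exists2 p, is_path p & spanning p.
Definition hamiltonian : Prop := exists2 p, is_cycle p & spanning p.

Definition connected : Prop := forall x y, connect (@adj G) x y.

Definition deg x : nat := #|[set y | adj x y]|.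

Definition induced_adj A : rel {x : G | x \in A} :=
  fun a b => adj (val a) (val b).

Lemma induced_adj_sym A : symmetric (@induced_adj A).
Proof. by move=> a b; rewrite /induced_adj adj_sym. Qed.

Lemma induced_adj_irrefl A : irreflexive (@induced_adj A).
Proof. by move=> a; rewrite /induced_adj adj_irrefl. Qed.

Definition induced A : sgraph :=
  SGraph (@induced_adj_sym A) (@induced_adj_irrefl A).

Definition del S : sgraph := induced (~: S).

End Graph.

Definition k_connected (k : nat) (G : sgraph) : Prop :=
  k < #|G| /\ forall S : {set G}, #|S| < k -> connected (del S).

Definition vertex_cut (G : sgraph) (S : {set G}) : Prop := ~ connected (del S).

Definition platypus (G : sgraph) : Prop :=
  ~ hamiltonian G /\ forall v : G, traceable (del [set v]).

Section Ear.
Variable G : sgraph.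
Implicit Types (v w x y : G) (p q : seq G).

(* A path is given by its vertex sequence, hence in two ways, one for each
   direction; containment is that of the underlying subgraphs. *)
Definition path_edge p x y : bool := infix [:: x; y] p || infix [:: y; x] p.

Definition subpath p q : Prop :=
  {subset p <= q} /\ forall x y, path_edge p x y -> path_edge q x y.

Definition proper_subpath p q : Prop := subpath p q /\ ~ subpath q p.

(* The ear conditions other than maximality. *)
Definition pre_ear (k : nat) p : Prop :=
  exists v w q,
    [/\ p = v :: rcons q w, is_path p, 2 < k /\ size p = k,
        vertex_cut [set v; w] & forall y, y \in q -> deg y = 2].

Definition is_ear (k : nat) p : Prop :=
  [/\ k_connected 2 G, pre_ear k p &
      forall k' p', pre_ear k' p' -> ~ proper_subpath p p'].

End Ear.

Section Replace.
Variables (G : sgraph) (v x w : G).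

(* [inl] embeds G - x; [inr false] and [inr true] are the new vertices x_1 and
   x_2. *)
Definition replace_adj : rel (del [set x] + bool) := fun a b =>
  match a, b with
  | inl y, inl z => adj y z
  | inl y, inr i => val y == (if i then w else v)
  | inr i, inl y => val y == (if i then w else v)
  | inr i, inr j => i != j
  end.

Lemma replace_adj_sym : symmetric replace_adj.
Proof. by case=> [y|i] [z|j] //=; [apply: adj_sym | rewrite eq_sym]. Qed.

Lemma replace_adj_irrefl : irreflexive replace_adj.
Proof. by case=> [y|i] /=; [apply: adj_irrefl | rewrite eqxx]. Qed.

Definition replace_3ear_by_4ear : sgraph :=
  SGraph replace_adj_sym replace_adj_irrefl.

End Replace.

(* Main.v *)
Require Import Defs.
From mathcomp Require Import all_boot.

Set Implicit Arguments.
Unset Strict Implicit.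
Unset Printing Implicit Defensive.

(** Let [x] have degree 2 with neighbours [v] and [w].  If [x] is replaced by
    [x_1] and [x_2], then deleting the new neighbour of [v] leaves [G - x] with
    a pendant vertex at [w], which is traceable if and only if [G - x] has a
    spanning path ending at [w].  So it suffices to find a platypus in which
    there is no such path; this also excludes spanning cycles of [G].

    In the graph below [x, v, w] are [0, 1, 2], and [G - x] is the union of two
    graphs that share only [5] and [2] and have no spanning path from [5] to
    [2]: one on [1, 2, 3, 4, 5], the other on [2, 5, 6, ..., 11], made of the
    triangles [5 6 9] and [2 10 11] and of two paths joining [6, 9] to
    [10, 11].  A spanning path of [G - x] ending at [w = 2] would have to cross
    one of the two parts entirely, from [5] to [2].  Yet [x] gives a spanning
    path of the first part plus [x], namely [5 4 3 1 0 2], which is what makes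
    most of the vertex-deleted subgraphs traceable. *)

Definition edges : seq (nat * nat) :=
  [:: (0, 1); (0, 2); (1, 3); (1, 5); (2, 3); (3, 4); (4, 5);
      (5, 6); (5, 9); (6, 9); (6, 8); (7, 9); (2, 10); (2, 11); (10, 11);
      (8, 10); (7, 11)].

Definition edge : rel nat :=
  fun i j => ((i, j) \in edges) || ((j, i) \in edges).

Lemma edge_sym : symmetric edge.
Proof. by move=> i j; rewrite /edge orbC. Qed.

Lemma ord_allP n (P : pred nat) : all P (iota 0 n) -> forall i : 'I_n, P i.
Proof. by move=> /allP Pn i; apply: Pn; rewrite mem_iota ltn_ord. Qed.

Definition edge12 : rel 'I_12 := relpre val edge.

Lemma edge12_sym : symmetric edge12.
Proof. by move=> i j; apply: edge_sym. Qed.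

Lemma edge12_irrefl : irreflexive edge12.
Proof.
have /ord_allP irr : all (fun k => ~~ edge k k) (iota 0 12) by [].
by move=> i; apply/negbTE/irr.
Qed.

Definition G12 : sgraph := SGraph edge12_sym edge12_irrefl.

(** * Exhaustive search for spanning paths and cycles *)

Section Search.
Variables (e : rel nat) (n : nat).

(* Filtering before the recursive call prunes the search even under
   call-by-value, where [&&] evaluates both sides. *)
Fixpoint can_extend (P : pred nat) (k : nat) (s : seq nat) (i : nat) : bool :=
  if k is k'.+1 then
    has (can_extend P k' (i :: s)) [seq j <- iota 0 n | e i j & j \notin i :: s]
  else P i.

(** Only completeness of the search is needed, since it serves to refute existence: the next vertex
    of [q] always survives the filter. *)
Lemma can_extend_path (P : pred nat) s i q :
  path e i q -> uniq (i :: q) -> ~~ has (mem s) q -> all (ltn^~ n) q ->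
  P (last i q) -> can_extend P (size q) s i.
Proof.
elim: q i s => [|j q IHq] i s //= /andP[eij ejq] /andP[].
rewrite inE negb_or => /andP[nij niq] Ujq.
rewrite negb_or => /andP[njs nqs] /andP[ltjn ltqn] Plast.
apply/hasP; exists j.
  by rewrite mem_filter eij mem_iota ltjn inE negb_or eq_sym nij njs.
apply: IHq => //; apply/hasPn=> y yq; rewrite inE negb_or.
by rewrite (hasPn nqs y yq) andbT; apply: contraNneq niq => <-.
Qed.

Variables (H : sgraph) (f : H -> nat).
Hypotheses (f_inj : injective f) (f_lt : forall a, f a < n).
Hypothesis f_adj : forall a b, adj a b -> e (f a) (f b).
Hypothesis cardH : #|H| = n.

Lemma spanning_size (p : seq H) : uniq p -> spanning p -> size p = n.
Proof. by move=> /card_uniqP <- sp; rewrite -cardH; apply: eq_card => a; apply: sp. Qed.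

Lemma can_extend_spanning (P : pred nat) (a : H) (q : seq H) :
  path (@adj H) a q -> uniq (a :: q) -> spanning (a :: q) ->
  P (f (last a q)) -> can_extend P n.-1 [::] (f a).
Proof.
move=> aq Uaq Saq Pq; rewrite -(spanning_size (p := a :: q)) //= -(size_map f).
apply: can_extend_path; rewrite ?last_map //.
- by rewrite path_map; apply: sub_path aq => b c; apply: f_adj.
- by rewrite -map_cons map_inj_uniq.
- by rewrite -all_predC; apply/allP.
- by apply/allP=> _ /mapP[b _ ->]; apply: f_lt.
Qed.

Lemma search_not_traceable :
  ~~ has (can_extend predT n.-1 [::]) (iota 0 n) -> ~ traceable H.
Proof.
move=> /hasPn no_path [[|a q] // /and3P[_ aq Uaq] Saq].
have /no_path/negP[] : f a \in iota 0 n by rewrite mem_iota f_lt.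
exact: can_extend_spanning Saq _.
Qed.

(** A spanning cycle can be rotated to begin at [a], so one starting vertex suffices; the search
    then asks the last vertex for an edge back to it. *)
Lemma search_not_hamiltonian (a : H) :
  ~~ can_extend (e^~ (f a)) n.-1 [::] (f a) -> ~ hamiltonian H.
Proof.
move=> /negP no_cycle [p /and3P[_ cp Up] Sp]; apply: no_cycle.
have [i q defp] := rot_to (Sp a).
have: cycle (@adj H) (a :: q) by rewrite -defp rot_cycle.
rewrite /= rcons_path => /andP[aq lqa].
apply: (can_extend_spanning (q := q)) => //; last exact: f_adj.
  by rewrite -defp rot_uniq.
by move=> b; rewrite -defp mem_rot.
Qed.

End Search.

(** * Traceability, connectedness and maximal ears *)

Section Generic.
Variable G : sgraph.
Implicit Types (v x w y : G) (p q s : seq G) (S : {set G}).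

Lemma del_traceable S s :
  is_path s -> (forall y, (y \in s) = (y \notin S)) -> traceable (del S).
Proof.
move=> /and3P[s0 ads Us] Ss.
pose t : seq (del S) := pmap insub s.
have tE : map val t = s.
  rewrite pmap_filter; last exact: insubK.
  apply/all_filterP/allP=> y ys.
  by case: insubP => //=; rewrite inE -Ss ys.
exists t.
  rewrite /is_path -(size_map val) tE s0 pmap_sub_uniq // andbT /=.
  by rewrite -tE sorted_map in ads.
move=> [y yS]; have := yS; rewrite inE -Ss -tE => /mapP[z zt] /= yz.
by rewrite (_ : exist _ y yS = z) //; apply: val_inj.
Qed.

Lemma traceable_connected : traceable G -> connected G.
Proof.
case=> [[|a q] // /and3P[_ aq _] Sq].
have from_a y : connect (@adj G) a y by apply: (path_connect aq).
move=> y z; apply: connect_trans (from_a z).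
by rewrite (sym_connect_sym (@adj_sym G)).
Qed.

Lemma path_edge_rev p x y : path_edge (rev p) x y = path_edge p x y.
Proof.
by rewrite /path_edge -(infix_rev [:: x; y]) -(infix_rev [:: y; x]) revK orbC.
Qed.

Lemma infix_index p x y :
  uniq p -> infix [:: x; y] p -> index y p = (index x p).+1.
Proof.
move=> Up /infixP[s1 [s2 defp]]; move: Up; rewrite defp cat_uniq /=.
rewrite negb_or !inE !negb_or => /and3P[_ /andP[xs1 /andP[ys1 _]] /andP[/andP[nxy _] _]].
rewrite !index_cat (negPf xs1) (negPf ys1) /= !eqxx (negPf nxy).
by rewrite addn1 addn0.
Qed.

Lemma path_edge_index p x y :
  uniq p -> path_edge p x y ->
  index y p = (index x p).+1 \/ index x p = (index y p).+1.
Proof. by move=> Up /orP[] /infix_index -> //; [left | right]. Qed.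

(* By their degrees [v] and [w] cannot be interior to [p], so they are its ends;
   as [x] is next to both of them on [p], no other interior vertex is left. *)
Lemma ear3_maximal v x w k p :
  uniq [:: v; x; w] -> deg v != 2 -> deg w != 2 -> pre_ear k p ->
  ~ proper_subpath [:: v; x; w] p.
Proof.
move=> Uvxw dv dw [a [b [q [defp /and3P[_ _ Up] _ _ dq]]]] [[sub_p edge_p]].
have [nxv nvw nxw] : [/\ x != v, v != w & x != w].
  by move: Uvxw; rewrite /= !inE negb_or andbT (eq_sym v x) => /andP[/andP[-> ->] ->].
have sz_a : index a p = 0 by rewrite defp /= eqxx.
have sz_b : index b p = (size q).+1.
  move: Up; rewrite defp -rcons_cons rcons_uniq => /andP[/negPf nb _].
  by rewrite -cats1 index_cat nb /= eqxx addn0.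
have end_of y : y \in [:: v; x; w] -> deg y != 2 -> (y == a) || (y == b).
  move=> /sub_p; rewrite defp inE mem_rcons inE => /or3P[->//|->|/dq->//].
  by rewrite orbT.
have evx : path_edge p v x by apply: edge_p; rewrite /path_edge /= !eqxx.
have exw : path_edge p x w by apply: edge_p; rewrite /path_edge /= !eqxx !orbT.
have xp : x \in p by apply: sub_p; rewrite !inE eqxx orbT.
have v_end : (v == a) || (v == b) by apply: end_of; rewrite // inE eqxx.
have w_end : (w == a) || (w == b) by apply: end_of; rewrite // !inE eqxx !orbT.
(* The ends have indices 0 and [(size q).+1], and [x] is at distance 1 from both. *)
have szq : size q = 1.
  have := path_edge_index Up evx; have := path_edge_index Up exw.
  case/orP: v_end nvw => /eqP->; case/orP: w_end => /eqP->; rewrite ?eqxx // => _.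
    by rewrite sz_a sz_b => -[[->]|->] [].
  by rewrite sz_a sz_b => -[//|->] [//|[->]].
have [y qy] : exists y, q = [:: y].
  by clear -szq; case: q szq => [|y []] // _; exists y.
have p_vxw : p = [:: v; x; w] \/ p = rev [:: v; x; w].
  move: xp; rewrite defp qy /= !inE.
  move: v_end w_end nvw nxv nxw => /orP[]/eqP-> /orP[]/eqP->; rewrite ?eqxx //;
    move=> _ /negPf-> /negPf->; rewrite ?orbF /=.
  - by move=> /eqP->; left.
  - by move=> /eqP->; right.
case; case: p_vxw => ->; first by split.
by split=> [z|z t]; rewrite ?mem_rev ?path_edge_rev.
Qed.

End Generic.

(** * The platypus on 12 vertices and its 3-ear *)

Lemma G12_path (S : {set G12}) (s : seq nat) :
  0 < size s -> sorted edge s -> uniq s -> all (ltn^~ 12) s ->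
  (forall i : G12, (val i \in s) = (i \notin S)) -> traceable (del S).
Proof.
move=> s0 es Us ltsn Ss; pose t : seq G12 := pmap insub s.
have tE : map val t = s.
  rewrite pmap_filter; last exact: insubK.
  by apply/all_filterP/allP=> k /(allP ltsn) ltk; rewrite insubT.
apply: (@del_traceable _ _ t) => [|i]; last first.
  by rewrite -Ss -tE mem_map //; apply: val_inj.
rewrite /is_path -(size_map val) tE s0 pmap_sub_uniq // andbT /=.
by rewrite -tE sorted_map in es.
Qed.

(** The entry at position [k] is a spanning path of [G12] minus [k]. *)
Definition G12_del_paths : seq (seq nat) :=
  [:: [:: 1; 3; 4; 5; 6; 8; 10; 2; 11; 7; 9];
      [:: 0; 2; 3; 4; 5; 6; 8; 10; 11; 7; 9];
      [:: 0; 1; 3; 4; 5; 6; 8; 10; 11; 7; 9];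
      [:: 4; 5; 1; 0; 2; 10; 8; 6; 9; 7; 11];
      [:: 0; 1; 3; 2; 10; 8; 6; 5; 9; 7; 11];
      [:: 4; 3; 1; 0; 2; 10; 8; 6; 9; 7; 11];
      [:: 0; 1; 3; 4; 5; 9; 7; 11; 2; 10; 8];
      [:: 0; 1; 3; 2; 11; 10; 8; 6; 9; 5; 4];
      [:: 0; 1; 3; 2; 10; 11; 7; 9; 6; 5; 4];
      [:: 0; 1; 3; 4; 5; 6; 8; 10; 2; 11; 7];
      [:: 0; 1; 5; 4; 3; 2; 11; 7; 9; 6; 8];
      [:: 0; 1; 5; 4; 3; 2; 10; 8; 6; 9; 7]].

Lemma G12_del1_traceable (u : G12) : traceable (del [set u]).
Proof.
pose s := nth [::] G12_del_paths u.
have /ord_allP ok : all (fun k => let s := nth [::] G12_del_paths k in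
    [&& 0 < size s, sorted edge s, uniq s, all (ltn^~ 12) s &
        all (fun i => (i \in s) == (i != k)) (iota 0 12)]) (iota 0 12) by [].
have /and5P[s0 es Us lts /ord_allP mem_s] := ok u.
by apply: (G12_path s0 es Us lts) => i; rewrite (eqP (mem_s i)) inE.
Qed.

Lemma G12_del0_traceable : traceable (del (set0 : {set G12})).
Proof.
(* This is the path avoiding 0 from the list, extended by the edge from 0 to 1. *)
pose s := [:: 0; 1; 3; 4; 5; 6; 8; 10; 2; 11; 7; 9].
have /ord_allP mem_s : all (fun k => k \in s) (iota 0 12) by [].
by apply: (@G12_path _ s) => // i; rewrite in_set0 mem_s.
Qed.

Lemma G12_not_hamiltonian : ~ hamiltonian G12.
Proof.
apply: (@search_not_hamiltonian edge 12 G12 val val_inj _ _ _ ord0) => //.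
- exact: ltn_ord.
- exact: card_ord.
Qed.

Lemma G12_platypus : platypus G12.
Proof. by split; [apply: G12_not_hamiltonian | apply: G12_del1_traceable]. Qed.

Lemma G12_2_connected : k_connected 2 G12.
Proof.
split=> [|S]; first by rewrite card_ord.
case: (set_0Vmem S) => [->|[u uS]] cardS; apply: traceable_connected.
  exact: G12_del0_traceable.
have /eqP <- : [set u] == S by rewrite eqEcard sub1set uS cards1.
exact: G12_del1_traceable.
Qed.

(** This turns degrees, cardinals of finite sets, into counts that evaluate by computation. *)
Lemma G12_deg (u : G12) : deg u = count (edge u) (iota 0 12).
Proof.
rewrite /deg cardsE cardE -val_enum_ord count_map size_filter.
by rewrite /enum_mem filter_predT.
Qed.

Definition G12v : G12 := @Ordinal 12 1 isT.
Definition G12w : G12 := @Ordinal 12 2 isT.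
Definition G12x : G12 := @Ordinal 12 0 isT.

(** Without its two neighbours, 0 is isolated, so no path leads from it to 3. *)
Lemma G12_vertex_cut : vertex_cut [set G12v; G12w].
Proof.
pose cut : {set G12} := [set G12v; G12w].
pose D z := z \in ~: cut.
have x_in : D G12x by rewrite /D !inE.
have y_in : D (@Ordinal 12 3 isT) by rewrite /D !inE.
move=> /(_ (exist D _ x_in) (exist D _ y_in)) /connectP[[|[z z_in] q] //=].
have /ord_allP nbr : all (fun k => edge 0 k ==> (k \in [:: 1; 2])) (iota 0 12) by [].
case/andP=> /(implyP (nbr z)) xz _ _.
by move: xz z_in; rewrite !inE -!val_eqE /= => ->.
Qed.

Lemma G12_ear : is_ear 3 [:: G12v; G12x; G12w].
Proof.
split; first exact: G12_2_connected.
- exists G12v, G12w, [:: G12x]; split=> // [|y]; first exact: G12_vertex_cut.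
  by rewrite inE => /eqP->; rewrite G12_deg.
- by move=> k p; apply: ear3_maximal; rewrite ?G12_deg.
Qed.

(** * The graph after the replacement *)

Section Replaced.
Let H := replace_3ear_by_4ear G12v G12x G12w.
Let K := del [set (inr false : H)].

(* After the deletion of [x_1], the vertex [x_2] takes over the number of
   [x]; only its edge to [w] remains. *)
Let code (a : K) : nat := if val a is inl y then val (val y) else 0.
Let edge' : rel nat := fun i j =>
  edge i j && ((i, j) \notin [:: (0, 1); (1, 0)]).

Lemma replaced_not_platypus : ~ platypus H.
Proof.
(* The number 0 is free for [x_2], which makes [code] injective. *)
have val_neq0 (y : del [set G12x]) : val (val y) != 0.
  by have := valP y; rewrite !inE -val_eqE.
have only_x2 i : (inr i : H) \in ~: [set (inr false : H)] -> i = true.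
  by rewrite !inE; case: i.
case=> _ /(_ (inr false)); apply: (@search_not_traceable edge' 12 K code).
- move=> [[y|i] aP] [[z|j] bP]; rewrite /code /= => ab; apply: val_inj => /=.
  + by move/val_inj/val_inj: ab => ->.
  + by move/eqP: ab; rewrite (negPf (val_neq0 y)).
  + by move/esym/eqP: ab; rewrite (negPf (val_neq0 z)).
  + by rewrite (only_x2 i aP) (only_x2 j bP).
- by case=> [[y|i] aP]; [apply: ltn_ord |].
- move=> [[y|i] aP] [[z|j] bP]; rewrite /code /adj /= /induced_adj /=.
  + move=> yz; apply/andP; split; first exact: yz.
    by rewrite !inE !xpair_eqE !(negPf (val_neq0 _)) andbF.
  + by rewrite (only_x2 j bP) => /eqP->.
  + by rewrite (only_x2 i aP) => /eqP->.
  + by rewrite (only_x2 i aP) (only_x2 j bP).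
(* Removing [x], adding two vertices and deleting one of them leaves 12. *)
- by rewrite card_sig cardsC1 card_sum card_bool card_sig cardsC1 card_ord.
- by vm_compute.
Qed.

End Replaced.

Theorem proposition14 :
  exists (G : sgraph) (v x w : G),
    [/\ 2 < #|G|, platypus G, is_ear 3 [:: v; x; w] &
        ~ platypus (replace_3ear_by_4ear v x w)].
Proof.
exists G12, G12v, G12x, G12w; split.
- by rewrite card_ord.
- exact: G12_platypus.
- exact: G12_ear.
- exact: replaced_not_platypus.
Qed.
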